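(* Let $\boldsymbol{\Phi}^I,\boldsymbol{\Phi}^D$ be real matrices with $N$ columns each, let $\mathbf{y}^I,\mathbf{y}^D$ be real vectors of matching dimensions with $\|\mathbf{y}^I\|_2=\|\mathbf{y}^D\|_2=:f_0$, and choose $U^I=U^D=U=f_0$ and $\epsilon^I=\epsilon^D=\eta f_0$, where $0\le\eta<1$. Let $\mathbf{a}^0,\mathbf{b}^0\in\mathbb{R}^N$ be sparse coefficient vectors satisfying $\|\mathbf{y}^I-\boldsymbol{\Phi}^I\mathbf{a}^0\|_2^2\le(\epsilon^I)^2$, $\|\mathbf{y}^D-\boldsymbol{\Phi}^D\mathbf{b}^0\|_2^2\le(\epsilon^D)^2$, and $|a^0_i|\le f_0$, $|b^0_i|\le f_0$ for all $i=1,\dots,N$. Let $\mathcal{T}_0$ and $\gamma$ be the joint support and the similarity parameter of $(\mathbf{a}^0,\mathbf{b}^0)$, and let $(\mathbf{x}^*,\mathbf{a}^*,\mathbf{b}^* )$ be an optimal solution of (OPT2) (all defined in the context). Then $$\big\|[\mathbf{a}^0;\mathbf{b}^0]-[\mathbf{a}^*;\mathbf{b}^*]\big\|_2^2\le\left[\frac{|\mathcal{T}_0|}{M}\big(C+\gamma\sqrt{|\mathcal{T}_0|}\big)^2+C^2\right]f_0^2$$ holds for a constant $C$ that depends on the signal model parameter $\gamma$, the sparse support size $|\mathcal{T}_0|$ and the approximation parameter $\eta$, and where the $M$-restricted isometry property is satisfied for the linear system with matrix $$\mathbf{A}=\begin{bmatrix}\boldsymbol{\Phi}^I&\mathbf{0}\\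 \mathbf{0}&\boldsymbol{\Phi}^D\end{bmatrix}.$$ In particular, with $\delta_S$ denoting the $S$-restricted isometry constant of $\mathbf{A}$, $$C=\frac{4\eta\sqrt{M}+\gamma|\mathcal{T}_0|\sqrt{1+\delta_M}}{\sqrt{M(1-\delta_{M+|\mathcal{T}_0|})}-\sqrt{|\mathcal{T}_0|(1+\delta_M)}}.$$
   Context: $[\mathbf{a};\mathbf{b}]\in\mathbb{R}^{2N}$ denotes the vector obtained by stacking $\mathbf{a}$ on top of $\mathbf{b}$, and $|\mathcal{T}|$ the cardinality of a set. Problem (OPT2) (Joint Basis Pursuit): over $\mathbf{x}\in[0,1]^N$, $\mathbf{a},\mathbf{b}\in\mathbb{R}^N$, minimize $\sum_{i=1}^N x_i$ subject to $\|\mathbf{y}^I-\boldsymbol{\Phi}^I\mathbf{a}\|_2^2\le(\epsilon^I)^2$, $\|\mathbf{y}^D-\boldsymbol{\Phi}^D\mathbf{b}\|_2^2\le(\epsilon^D)^2$, $|a_i|\le U^I x_i$ and $|b_i|\le U^D x_i$ for $i=1,\dots,N$. Joint support: $\mathbf{x}^0$ is the auxiliary vector with $U x^0_i=\max\{|a^0_i|,|b^0_i|\}$, so that $(\mathbf{x}^0,\mathbf{a}^0,\mathbf{b}^0)$ is feasible for (OPT2), and $\mathcal{T}_0$ is the support of $\mathbf{x}^0$. In the setting, $\mathcal{T}_0$ is at the same time the support of at least one of $\mathbf{a}^0,\mathbf{b}^0$ and contains the support of the other (or coincides with both supports). Similarity parameter: for $i\in\mathcal{T}_0$, $\alpha_i=\min\{|a^0_i|/|b^0_i|,\,|b^0_i|/|a^0_i|\}$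 (read as $0$ if exactly one of $a^0_i,b^0_i$ vanishes), and $\gamma=1-\min_{i\in\mathcal{T}_0}\alpha_i$. Restricted isometry: the $S$-restricted isometry constant $\delta_S$ of $\mathbf{A}$ is the smallest quantity such that $(1-\delta_S)\|\mathbf{s}\|_2^2\le\|\mathbf{A}_{\mathcal{T}}\mathbf{s}\|_2^2\le(1+\delta_S)\|\mathbf{s}\|_2^2$ for all sets $\mathcal{T}$ of column indices of $\mathbf{A}$ with $|\mathcal{T}|\le S$ and all coefficient sequences $\mathbf{s}=(s_j)_{j\in\mathcal{T}}$, where $\mathbf{A}_{\mathcal{T}}$ is the submatrix of $\mathbf{A}$ formed by the columns indexed by $\mathcal{T}$. It is assumed that $\mathbf{A}$ satisfies the restricted isometry property with such constants.
   Formalization: The formal theorem assumes M ≥ 1 and that the denominator of C is positive; without the latter the claim fails, e.g. Φ^I=Φ^D=[1 1], y^I=y^D=1, η=0, a^0=b^0=(1,0), M=1 gives C=0, yet a^*=b^*=(0,1) is optimal. *)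

(* Defs.v *)
From HB Require Import structures.
From mathcomp Require Import all_boot all_order all_algebra.
From mathcomp Require Import reals.

Set Implicit Arguments.
Unset Strict Implicit.
Unset Printing Implicit Defensive.

Import Order.TTheory GRing.Theory Num.Theory.

Local Open Scope ring_scope.

(* The Euclidean norm; the canonical norm on matrices in MathComp-Analysis is
   the sup norm. *)
Definition norm2 (R : realType) (n : nat) (v : 'cV[R]_n) : R :=
  Num.sqrt (\sum_i v i 0 ^+ 2).

Definition supp (R : realType) (n : nat) (v : 'cV[R]_n) : {set 'I_n} :=
  [set i | v i 0 != 0].

(* Joint basis pursuit: minimize sum_i x_i, where a and b are coupled only
   through the common bound x on the magnitudes of their entries. *)
Definition jbp_feasible (R : realType) (N mI mD : nat)
    (PhiI : 'M[R]_(mI, N)) (PhiD : 'M[R]_(mD, N))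
    (yI : 'cV[R]_mI) (yD : 'cV[R]_mD) (UI UD epsI epsD : R)
    (x a b : 'cV[R]_N) : Prop :=
  [/\ forall i, 0 <= x i 0 <= 1,
      norm2 (yI - PhiI *m a) ^+ 2 <= epsI ^+ 2,
      norm2 (yD - PhiD *m b) ^+ 2 <= epsD ^+ 2,
      forall i, `|a i 0| <= UI * x i 0 &
      forall i, `|b i 0| <= UD * x i 0].

Definition jbp_optimal (R : realType) (N mI mD : nat)
    (PhiI : 'M[R]_(mI, N)) (PhiD : 'M[R]_(mD, N))
    (yI : 'cV[R]_mI) (yD : 'cV[R]_mD) (UI UD epsI epsD : R)
    (x a b : 'cV[R]_N) : Prop :=
  jbp_feasible PhiI PhiD yI yD UI UD epsI epsD x a b /\
  forall x' a' b' : 'cV[R]_N,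
    jbp_feasible PhiI PhiD yI yD UI UD epsI epsD x' a' b' ->
    \sum_i x i 0 <= \sum_i x' i 0.

(* If exactly one of a_i, b_i vanishes, both quotients are 0, since 0^-1 = 0. *)
Definition entry_similarity (R : realType) (N : nat) (a b : 'cV[R]_N)
    (i : 'I_N) : R :=
  Num.min (`|a i 0| / `|b i 0|) (`|b i 0| / `|a i 0|).

(* Every entry_similarity is at most 1, so the initial value 1 does not alter
   the minimum over a nonempty T. *)
Definition similarity (R : realType) (N : nat) (a b : 'cV[R]_N)
    (T : {set 'I_N}) : R :=
  1 - \big[Num.min/1]_(i in T) entry_similarity a b i.

Definition rip (R : realType) (m n : nat) (A : 'M[R]_(m, n)) (S : nat)
    (delta : R) : Prop :=
  forall (T : {set 'I_n}) (s : 'cV[R]_#|T|), (#|T| <= S)%N ->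
    let AT : 'M[R]_(m, #|T|) := colsub (fun k : 'I_#|T| => enum_val k) A in
    (1 - delta) * norm2 s ^+ 2 <= norm2 (AT *m s) ^+ 2
      <= (1 + delta) * norm2 s ^+ 2.

Definition is_ric (R : realType) (m n : nat) (A : 'M[R]_(m, n)) (S : nat)
    (delta : R) : Prop :=
  rip A S delta /\ forall delta' : R, rip A S delta' -> delta <= delta'.

(* k is the size of the joint support, deltaM and deltaMk are the restricted
   isometry constants of orders M and M + k. Num.sqrt is 0 on negative numbers,
   so 0 < jbp_denom forces 0 < M and deltaMk < 1. *)
Definition jbp_denom (R : realType) (M k : nat) (deltaM deltaMk : R) : R :=
  Num.sqrt (M%:R * (1 - deltaMk)) - Num.sqrt (k%:R * (1 + deltaM)).

Definition jbp_const (R : realType) (gamma eta : R) (M k : nat)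
    (deltaM deltaMk : R) : R :=
  (4%:R * eta * Num.sqrt M%:R + gamma * k%:R * Num.sqrt (1 + deltaM))
    / jbp_denom M k deltaM deltaMk.

(* Main.v *)
Require Import Defs.
From HB Require Import structures.
From mathcomp Require Import all_boot all_order all_algebra.
From mathcomp Require Import reals.
From mathcomp Require Import ring lra.

Set Implicit Arguments.
Unset Strict Implicit.
Unset Printing Implicit Defensive.

Import Order.TTheory GRing.Theory Num.Theory.

Local Open Scope ring_scope.

(* A is block diagonal, so its restricted isometry property passes to PhiI and
   PhiD with the same constants and orders, and the error can be estimated block
   by block. With c_i = max(|a0_i|, |b0_i|), optimality gives
   sum |a*_i| <= sum_(i in T0) c_i, hence the cone condition
   |h_(T0^c)|_1 <= |h_(T0)|_1 + ga for h = a0 - a*, with slack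
   ga = sum_(i in T0) (c_i - |a0_i|), and likewise for b with slack gb. The
   Candes-Romberg-Tao shelling argument bounds each error linearly in its slack
   and in 2 eta f0. At every i one of the two slack terms vanishes, so
   ga + gb <= gamma |T0| f0; adding the linear bounds before squaring, through
   p^2 + q^2 <= (p + q)^2, gives exactly the constant C. *)

(** * Cauchy-Schwarz and the Euclidean norm *)

Lemma cauchy_schwarz_sum (R : realDomainType) (I : finType) (P : pred I)
    (f g : I -> R) :
  (\sum_(i | P i) f i * g i) ^+ 2 <=
    (\sum_(i | P i) f i ^+ 2) * (\sum_(i | P i) g i ^+ 2).
Proof.
have E (p q : I -> R) : (\sum_(i | P i) p i) * (\sum_(i | P i) q i) =
    \sum_(i | P i) \sum_(j | P j) p i * q j.
  by rewrite mulr_suml; apply: eq_bigr => i _; rewrite mulr_sumr.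
(* Lagrange's identity: this double sum is twice the difference of the two sides. *)
have H : 0 <= \sum_(i | P i) \sum_(j | P j) (f i * g j - f j * g i) ^+ 2.
  by do 2!apply: sumr_ge0 => ? _; exact: sqr_ge0.
have {H}: 0 <= (\sum_(i | P i) f i ^+ 2) * (\sum_(i | P i) g i ^+ 2) *+ 2
    - (\sum_(i | P i) f i * g i) ^+ 2 *+ 2.
  apply: le_trans H _; rewrite expr2 mulr2n {2}mulrC !E -sumrMnl -big_split.
  rewrite -sumrB /= le_eqVlt; apply/orP; left; apply/eqP.
  apply: eq_bigr => i _; rewrite -sumrMnl -big_split -sumrB /=.
  by apply: eq_bigr => j _; ring.
by rewrite subr_ge0 lerMn2r.
Qed.

Lemma norm2_ge0 (R : realType) (n : nat) (v : 'cV[R]_n) : 0 <= norm2 v.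
Proof. exact: sqrtr_ge0. Qed.

Lemma norm2_sqr (R : realType) (n : nat) (v : 'cV[R]_n) :
  norm2 v ^+ 2 = \sum_i v i 0 ^+ 2.
Proof. by rewrite sqr_sqrtr // sumr_ge0 // => i _; exact: sqr_ge0. Qed.

Lemma norm2_opp (R : realType) (n : nat) (v : 'cV[R]_n) : norm2 (- v) = norm2 v.
Proof. by congr Num.sqrt; apply: eq_bigr => i _; rewrite mxE sqrrN. Qed.

Lemma norm2_0 (R : realType) (n : nat) : norm2 (0 : 'cV[R]_n) = 0.
Proof.
by rewrite /norm2 big1 ?sqrtr0 // => i _; rewrite mxE expr0n.
Qed.

Lemma ler_norm2D (R : realType) (n : nat) (u v : 'cV[R]_n) :
  norm2 (u + v) <= norm2 u + norm2 v.
Proof.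
have uv0 : 0 <= norm2 u * norm2 v by rewrite mulr_ge0 ?norm2_ge0.
rewrite -ler_sqr ?nnegrE ?addr_ge0 ?norm2_ge0 // sqrrD !norm2_sqr.
under eq_bigr do rewrite mxE sqrrD.
rewrite !big_split /= lerD2r lerD2l -mulr2n lerMn2r /=.
apply: le_trans (ler_norm _) _.
rewrite -ler_sqr ?nnegrE // exprMn !norm2_sqr real_normK ?num_real //.
exact: cauchy_schwarz_sum.
Qed.

Lemma ler_norm2B (R : realType) (n : nat) (u v : 'cV[R]_n) :
  norm2 (u - v) <= norm2 u + norm2 v.
Proof. by rewrite -(norm2_opp v) ler_norm2D. Qed.

Lemma norm2_col_mx (R : realType) (m n : nat) (u : 'cV[R]_m) (v : 'cV[R]_n) :
  norm2 (col_mx u v) ^+ 2 = norm2 u ^+ 2 + norm2 v ^+ 2.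
Proof.
rewrite !norm2_sqr big_split_ord /=.
under eq_bigr do rewrite col_mxEu.
by under [X in _ + X]eq_bigr do rewrite col_mxEd.
Qed.

Lemma sum_norm_le_norm2 (R : realType) (n : nat) (T : {set 'I_n})
    (v : 'cV[R]_n) :
  \sum_(i in T) `|v i 0| <=
    Num.sqrt #|T|%:R * Num.sqrt (\sum_(i in T) v i 0 ^+ 2).
Proof.
have S0 : 0 <= \sum_(i in T) `|v i 0| by apply: sumr_ge0.
have Q0 : 0 <= \sum_(i in T) v i 0 ^+ 2.
  by apply: sumr_ge0 => i _; exact: sqr_ge0.
rewrite -ler_sqr ?nnegrE ?mulr_ge0 ?sqrtr_ge0 //.
rewrite exprMn !sqr_sqrtr ?ler0n //.
have := cauchy_schwarz_sum (mem T) (fun=> 1) (fun i => `|v i 0|).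
under eq_bigr do rewrite mul1r.
rewrite expr1n sumr_const.
by under [X in _ * X]eq_bigr do rewrite real_normK ?num_real //.
Qed.

(** * Restriction of vectors to index sets *)

(** Zeroing entries keeps the dimension, so that matrices still apply and the pieces of a vector can
    be added. *)
Definition restr (R : realType) (n : nat) (T : {set 'I_n}) (v : 'cV[R]_n) :
  'cV[R]_n :=
  \col_i (if i \in T then v i 0 else 0).

Lemma supp_restr (R : realType) (n : nat) (T : {set 'I_n}) (v : 'cV[R]_n) :
  supp (restr T v) = T :&: supp v.
Proof. by apply/setP => i; rewrite !inE mxE; case: ifP; rewrite ?eqxx. Qed.

Lemma restr_addC (R : realType) (n : nat) (T : {set 'I_n}) (v : 'cV[R]_n) :
  restr T v + restr (~: T) v = v.
Proof.
apply/matrixP => i j; rewrite !mxE inE (ord1 j).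
by case: (i \in T); rewrite ?addr0 ?add0r.
Qed.

Lemma restr_restr (R : realType) (n : nat) (S T : {set 'I_n}) (v : 'cV[R]_n) :
  restr S (restr T v) = restr (S :&: T) v.
Proof. by apply/matrixP => i j; rewrite !mxE inE; do 2!case: (_ \in _). Qed.

Lemma sum_restr (R : realType) (n : nat) (T : {set 'I_n}) (v : 'cV[R]_n)
    (F : R -> R) :
  F 0 = 0 -> \sum_i F (restr T v i 0) = \sum_(i in T) F (v i 0).
Proof.
move=> F0; rewrite [RHS]big_mkcond.
by apply: eq_bigr => i _; rewrite mxE; case: ifP.
Qed.

Lemma norm2_restr (R : realType) (n : nat) (T : {set 'I_n}) (v : 'cV[R]_n) :
  norm2 (restr T v) = Num.sqrt (\sum_(i in T) v i 0 ^+ 2).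
Proof. by rewrite /norm2 (sum_restr _ _ (F := fun x => x ^+ 2)) ?expr0n. Qed.

Lemma norm2_split (R : realType) (n : nat) (T : {set 'I_n}) (v : 'cV[R]_n) :
  norm2 v ^+ 2 = norm2 (restr T v) ^+ 2 + norm2 (restr (~: T) v) ^+ 2.
Proof.
rewrite !norm2_sqr !(sum_restr _ _ (F := fun x => x ^+ 2)) ?expr0n //.
by rewrite (bigID (mem T)) /=; congr (_ + _); apply: eq_bigl => i; rewrite inE.
Qed.

(** * Shelling and the error bound for one block *)

(** Greedy choice: at each stage a maximizer of [f] on what is left of [A] joins [T]. *)
Lemma exists_top_subset (R : realType) (I : finType) (f : I -> R)
    (A : {set I}) (M : nat) : (M <= #|A|)%N ->
  exists T : {set I}, [/\ T \subset A, #|T| = M &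
    forall i j, i \in T -> j \in A :\: T -> f j <= f i].
Proof.
elim: M => [|M IH] HM.
  by exists set0; split; rewrite ?sub0set ?cards0 // => i j; rewrite inE.
have [T [sTA cT topT]] := IH (ltnW HM).
have /card_gt0P [i0 Hi0] : (0 < #|A :\: T|)%N.
  by rewrite cardsD (setIidPr sTA) cT subn_gt0.
case: (arg_maxP f Hi0) => i Hi maxi.
have [iT iA] : i \notin T /\ i \in A.
  by move: (Hi : i \in A :\: T); rewrite inE => /andP[].
exists (i |: T); split.
- by rewrite subUset sub1set iA.
- by rewrite cardsU1 iT cT.
- move=> p q; rewrite !inE negb_or => /orP[/eqP->|pT] /andP[/andP[qi qT] qA].
    by apply: (maxi q : q \in A :\: T -> _); rewrite inE qT.
  by apply: topT => //; rewrite inE qT.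
Qed.

(* The vector off [T] is the sum of the blocks of its M largest entries, taken
   in decreasing order: each block has 2-norm at most M^(-1/2) times the 1-norm
   of the block before it, the block on [T] being the first. *)
Lemma shelling (R : realType) (n M : nat) (v : 'cV[R]_n) : (0 < M)%N ->
  exists T : {set 'I_n}, (#|T| <= M)%N /\
    forall m (Phi : 'M[R]_(m, n)) (s : R), 0 <= s ->
      (forall u, (#|supp u| <= M)%N -> norm2 (Phi *m u) <= s * norm2 u) ->
      Num.sqrt M%:R * norm2 (Phi *m restr (~: T) v) <= s * \sum_i `|v i 0|.
Proof.
move=> M0; have [k] := ubnP #|supp v|; elim: k v => // k IH v.
rewrite ltnS => Hk.
have [small|large] := leqP #|supp v| M.
  exists (supp v); split=> // m Phi s s0 _.
  have -> : restr (~: supp v) v = 0.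
    apply/matrixP => i j; rewrite !mxE !inE negbK.
    by case: eqP.
  by rewrite mulmx0 norm2_0 mulr0 mulr_ge0 // sumr_ge0.
(* [T] is the first block. The rest [r] has smaller support since [0 < M], and the induction
   hypothesis supplies its first block [T2]. *)
have [T [sT cT topT]] := exists_top_subset (fun i => `|v i 0|) (ltnW large).
set r := restr (~: T) v.
have suppr : supp r = supp v :\: T by rewrite supp_restr setIC setDE.
have [|T2 [cT2 HT2]] := IH r.
  rewrite suppr cardsD (setIidPr sT) cT; apply: leq_trans Hk.
  by rewrite ltn_subrL M0 (leq_ltn_trans _ large).
exists T; split=> [|m Phi s s0 HPhi]; first by rewrite cT.
have bnd j : M%:R * `|r j 0| <= \sum_(i in T) `|v i 0|.
  rewrite -cT mulr_natl -sumr_const; apply: ler_sum => i iT.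
  rewrite /r mxE inE; case: ifPn => jT; last by rewrite normr0.
  have [->|vj] := eqVneq (v j 0) 0; first by rewrite normr0.
  by apply: topT => //; rewrite !inE jT.
have M0' : 0 < M%:R :> R by rewrite ltr0n.
(* The mean over [T] bounds every entry of [r]; as [T2] has at most [M] elements, [r] has 2-norm at
   most [Num.sqrt M%:R * t] there. *)
set t := (\sum_(i in T) `|v i 0|) / M%:R.
have t0 : 0 <= t by rewrite divr_ge0 ?ler0n ?sumr_ge0.
have rt j : `|r j 0| <= t by rewrite ler_pdivlMr // mulrC.
have E : Num.sqrt M%:R * norm2 (restr T2 r) <= \sum_(i in T) `|v i 0|.
  have -> : \sum_(i in T) `|v i 0| = Num.sqrt M%:R * (Num.sqrt M%:R * t).
    by rewrite mulrA -expr2 sqr_sqrtr ?ler0n // mulrC divfK ?gt_eqF.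
  apply: ler_wpM2l; first exact: sqrtr_ge0.
  rewrite norm2_restr -[leRHS]ger0_norm ?(mulr_ge0 (sqrtr_ge0 _) t0) //.
  rewrite -sqrtr_sqr exprMn sqr_sqrtr ?ler0n // ler_wsqrtr //.
  apply: le_trans (_ : \sum_(i in T2) t ^+ 2 <= _).
    apply: ler_sum => i _; rewrite -(real_normK (num_real (r i 0))).
    by rewrite ler_sqr ?nnegrE.
  by rewrite sumr_const -[_ *+ #|_|]mulr_natl ler_wpM2r ?sqr_ge0 // ler_nat.
have Sv : \sum_i `|v i 0| = \sum_(i in T) `|v i 0| + \sum_i `|r i 0|.
  rewrite (sum_restr _ _ (F := Num.norm)) ?normr0 // (bigID (mem T)) /=.
  by congr (_ + _); apply: eq_bigl => i; rewrite inE.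
have B2 : norm2 (Phi *m restr T2 r) <= s * norm2 (restr T2 r).
  by apply: HPhi; rewrite supp_restr
    (leq_trans (subset_leq_card (subsetIl _ _))).
(* The 1-norm on [T] pays for the block [T2], and the 1-norm of [r] pays for all later blocks. *)
have -> : restr (~: T) v = restr T2 r + restr (~: T2) r by rewrite restr_addC.
rewrite mulmxDr Sv mulrDr.
apply: le_trans (ler_wpM2l (sqrtr_ge0 _) (ler_norm2D _ _)) _.
rewrite mulrDr lerD ?HT2 //.
apply: le_trans (ler_wpM2l (sqrtr_ge0 _) B2) _.
by rewrite mulrCA ler_wpM2l.
Qed.

(* The Candes-Romberg-Tao error bound for one block, with [T] in the role of
   the true support and slack [g] in the cone condition; [w] is the norm of
   [h] on [T] and the first shell. *)
Lemma sparse_error (R : realType) (m n M : nat) (Phi : 'M[R]_(m, n))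
    (T : {set 'I_n}) (h : 'cV[R]_n) (l s g : R) :
  (0 < M)%N -> 0 <= s ->
  (forall u, (#|supp u| <= M + #|T|)%N -> l * norm2 u <= norm2 (Phi *m u)) ->
  (forall u, (#|supp u| <= M)%N -> norm2 (Phi *m u) <= s * norm2 u) ->
  \sum_(i in ~: T) `|h i 0| <= \sum_(i in T) `|h i 0| + g ->
  exists w, [/\ 0 <= w,
    (Num.sqrt M%:R * l - Num.sqrt #|T|%:R * s) * w <=
      Num.sqrt M%:R * norm2 (Phi *m h) + s * g,
    0 <= Num.sqrt #|T|%:R * w + g &
    norm2 h ^+ 2 <= (Num.sqrt #|T|%:R * w + g) ^+ 2 / M%:R + w ^+ 2].
Proof.
move=> M0 s0 lower upper cone.
have [T1 [cT1 shell]] := shelling (restr (~: T) h) M0.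
rewrite (sum_restr _ _ (F := Num.norm)) ?normr0 // restr_restr -setCU setUC
  in shell.
set S := T :|: T1 in shell; set r := restr (~: S) h in shell.
set w := norm2 (restr S h).
set sM := Num.sqrt M%:R in shell *; set sT := Num.sqrt #|T|%:R.
have sM0 : 0 <= sM by exact: sqrtr_ge0.
have w0 : 0 <= w by exact: norm2_ge0.
have sumT : \sum_(i in T) `|h i 0| <= sT * w.
  apply: le_trans (sum_norm_le_norm2 _ _) _.
  rewrite /w norm2_restr ler_wpM2l ?sqrtr_ge0 // ler_wsqrtr //.
  rewrite [leRHS](big_setID T) /= (setIidPr (subsetUl _ _)) lerDl.
  by apply: sumr_ge0 => i _; exact: sqr_ge0.
have cone' : \sum_(i in ~: T) `|h i 0| <= sT * w + g.
  by apply: le_trans cone _; rewrite lerD2r.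
(* This sign later allows the bounds of the two blocks to be added before squaring. *)
have tail0 : 0 <= sT * w + g by apply: le_trans cone'; exact: sumr_ge0.
exists w; split=> //.
  (* [h] splits into [restr S h], with at most [M + #|T|] nonzero entries, where the lower isometry
     bound applies, and the shelled tail [r]. *)
  have low : l * w <= norm2 (Phi *m h) + norm2 (Phi *m r).
    have -> : Phi *m h = Phi *m restr S h + Phi *m r.
      by rewrite -mulmxDr restr_addC.
    apply: le_trans (lower _ _) _.
      rewrite supp_restr (leq_trans (subset_leq_card (subsetIl _ _))) //.
      by rewrite (leq_trans (leq_card_setU _ _)) // addnC leq_add2r.
    by rewrite -[X in norm2 X <= _](addrK (Phi *m r)) ler_norm2B.
  have high : sM * norm2 (Phi *m r) <= s * (sT * w + g).
    by apply: le_trans (shell _ Phi s s0 upper) _; rewrite ler_wpM2l.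
  have := ler_wpM2l sM0 low; move: high; rewrite !mulrDr => high low'.
  by rewrite mulrBl lerBlDr; lra.
rewrite (norm2_split S h) addrC lerD2r ler_pdivlMr ?ltr0n //.
(* [shelling] fixes its set before the matrix, so the same tail can be measured with the identity
   and [s = 1]. *)
have high : sM * norm2 r <= sT * w + g.
  have := shell _ 1%:M 1 ler01; rewrite !mul1mx mul1r => sh.
  by apply: le_trans (sh _) cone' => u _; rewrite mul1mx mul1r.
rewrite mulrC -(sqr_sqrtr (ler0n R M)) -exprMn ler_sqr ?nnegrE ?mulr_ge0 //.
exact: norm2_ge0.
Qed.

(** * Restricted isometry for sparse vectors and for the diagonal blocks *)

Lemma rip_supp (R : realType) (m n : nat) (A : 'M[R]_(m, n)) (S : nat)
    (delta : R) (v : 'cV[R]_n) : rip A S delta -> (#|supp v| <= S)%N ->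
  Num.sqrt (1 - delta) * norm2 v <= norm2 (A *m v)
    <= Num.sqrt (1 + delta) * norm2 v.
Proof.
move=> ripA cv; have /= := ripA (supp v) (\col_k v (enum_val k) 0) cv.
set s := \col_k _; set AT := colsub _ _.
have sum_supp (F : 'I_n -> R) : (forall i, v i 0 = 0 -> F i = 0) ->
    \sum_i F i = \sum_(k < #|supp v|) F (enum_val k).
  move=> F0; rewrite -(big_enum_val F) [RHS]big_mkcond.
  by apply: eq_bigr => i _; rewrite inE; case: eqP => // /F0.
have -> : norm2 s = norm2 v.
  congr Num.sqrt; rewrite [RHS]sum_supp; last by move=> i ->; rewrite expr0n.
  by apply: eq_bigr => k _; rewrite mxE.
have -> : AT *m s = A *m v.
  apply/matrixP => i j; rewrite !mxE (ord1 j) [RHS]sum_supp.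
    by apply: eq_bigr => k _; rewrite !mxE.
  by move=> k ->; rewrite mulr0.
move=> /andP[lo hi].
have nE k (u : 'cV[R]_k) : norm2 u = Num.sqrt (norm2 u ^+ 2).
  by rewrite sqrtr_sqr ger0_norm ?norm2_ge0.
(* If [1 - delta] is negative, its [Num.sqrt] is 0 and the lower bound is trivial; monotonicity of
   [Num.sqrt] covers this case too. *)
rewrite (nE _ v) (nE _ (A *m v)) ![Num.sqrt (1 + _) * _]mulrC.
by rewrite -!sqrtrM ?sqr_ge0 // !ler_wsqrtr // mulrC.
Qed.

Lemma card_supp_col_mx (R : realType) (m n : nat) (u : 'cV[R]_m)
    (v : 'cV[R]_n) :
  #|supp (col_mx u v)| = (#|supp u| + #|supp v|)%N.
Proof.
rewrite -!sum1_card !(big_mkcond (fun i => i \in supp _)) big_split_ord /=.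
by congr (_ + _)%N; apply: eq_bigr => i _; rewrite !inE ?col_mxEu ?col_mxEd.
Qed.

(** Padding [u] with a zero block changes neither its norm nor its support size, and the block
    matrix sends it to the padded image. *)
Lemma rip_block_diag (R : realType) (N mI mD S : nat)
    (PhiI : 'M[R]_(mI, N)) (PhiD : 'M[R]_(mD, N)) (delta : R) :
  rip (block_mx PhiI 0 0 PhiD) S delta ->
  forall u : 'cV[R]_N, (#|supp u| <= S)%N ->
    (Num.sqrt (1 - delta) * norm2 u <= norm2 (PhiI *m u)
      <= Num.sqrt (1 + delta) * norm2 u) /\
    (Num.sqrt (1 - delta) * norm2 u <= norm2 (PhiD *m u)
      <= Num.sqrt (1 + delta) * norm2 u).
Proof.
move=> ripA u cu.
have supp0 : #|supp (0 : 'cV[R]_N)| = 0%N.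
  by apply: eq_card0 => i; rewrite !inE mxE eqxx.
have nul k l (w : 'cV[R]_k) : norm2 (col_mx w (0 : 'cV[R]_l)) = norm2 w.
  apply/eqP; rewrite -(eqrXn2 (n := 2)) ?norm2_ge0 // norm2_col_mx.
  by rewrite norm2_0 expr0n addr0.
have ndr k l (w : 'cV[R]_k) : norm2 (col_mx (0 : 'cV[R]_l) w) = norm2 w.
  apply/eqP; rewrite -(eqrXn2 (n := 2)) ?norm2_ge0 // norm2_col_mx.
  by rewrite norm2_0 expr0n add0r.
split; [have := @rip_supp _ _ _ _ _ _ (col_mx u 0) ripA |
        have := @rip_supp _ _ _ _ _ _ (col_mx 0 u) ripA];
  rewrite card_supp_col_mx supp0 mul_block_col !mul0mx !mulmx0.
- by rewrite addn0 !addr0 !nul; apply.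
- by rewrite add0n !add0r !ndr; apply.
Qed.

(** * Consequences of optimality and of similarity *)

(** Off [T] the error is [- a]; on [T] the triangle inequality bounds |a0_i| by |a_i| + |a0_i -
    a_i|. *)
Lemma cone_condition (R : realType) (n : nat) (T : {set 'I_n})
    (a0 a : 'cV[R]_n) (c : 'I_n -> R) :
  (forall i, i \notin T -> a0 i 0 = 0) ->
  \sum_i `|a i 0| <= \sum_(i in T) c i ->
  \sum_(i in ~: T) `|(a0 - a) i 0| <=
    \sum_(i in T) `|(a0 - a) i 0| + \sum_(i in T) (c i - `|a0 i 0|).
Proof.
move=> a00; rewrite (bigID (mem T)) /= => le_c.
have -> : \sum_(i in ~: T) `|(a0 - a) i 0| = \sum_(i | i \notin T) `|a i 0|.
  apply: eq_big => [i|i]; rewrite !inE // => iT.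
  by rewrite !mxE a00 // sub0r normrN.
rewrite -lerBrDl in le_c; apply: le_trans le_c _.
rewrite lerBlDl -!big_split /=; apply: ler_sum => i _.
have := ler_normD (a i 0) (a0 i 0 - a i 0).
by rewrite addrCA subrr addr0 !mxE; lra.
Qed.

(** The larger magnitude [q] leaves no gap. The smaller one [p] leaves [q - p = (1 - p / q) * q]
    when [0 < q], with the first factor at most [similarity a b T] and the second at most [f0]. *)
Lemma similarity_gap (R : realType) (N : nat) (a b : 'cV[R]_N)
    (T : {set 'I_N}) (f0 : R) (i : 'I_N) :
  i \in T -> `|a i 0| <= f0 -> `|b i 0| <= f0 ->
  let c := Num.max `|a i 0| `|b i 0| in
  (c - `|a i 0|) + (c - `|b i 0|) <= similarity a b T * f0.
Proof.
move=> iT af bf /=; set g := similarity a b T.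
have g0 : 0 <= g by rewrite subr_ge0 bigmin_le_id.
have gi : 1 - entry_similarity a b i <= g.
  by rewrite lerD2l lerN2; exact: bigmin_le_cond.
have gap p q : 0 <= p -> p <= q -> q <= f0 -> entry_similarity a b i <= p / q ->
    q - p <= g * f0.
  move=> p0 pq qf le_r; have [q0|q0] := leP q 0.
    apply: le_trans (_ : 0 <= _); first by lra.
    by rewrite mulr_ge0 // (le_trans p0) // (le_trans pq).
  rewrite ler_pdivlMr // in le_r.
  have : (1 - entry_similarity a b i) * q <= g * f0.
    by apply: le_trans (ler_wpM2r (ltW q0) gi) _; rewrite ler_wpM2l.
  by rewrite mulrBl mul1r; lra.
have [ab|/ltW ba] := leP `|a i 0| `|b i 0|.
  by rewrite subrr addr0; apply: gap; rewrite // ge_min lexx.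
by rewrite subrr add0r; apply: gap; rewrite // ge_min lexx orbT.
Qed.

Theorem theorem1 (R : realType) (N mI mD M : nat)
    (PhiI : 'M[R]_(mI, N)) (PhiD : 'M[R]_(mD, N))
    (yI : 'cV[R]_mI) (yD : 'cV[R]_mD) (f0 eta : R)
    (x0 a0 b0 xopt aopt bopt : 'cV[R]_N) (deltaM deltaMT : R) :
  let T0 := supp x0 in
  let gamma := similarity a0 b0 T0 in
  let A := block_mx PhiI 0 0 PhiD in
  let C := jbp_const gamma eta M #|T0| deltaM deltaMT in
  norm2 yI = f0 -> norm2 yD = f0 ->
  0 <= eta -> eta < 1 ->
  norm2 (yI - PhiI *m a0) ^+ 2 <= (eta * f0) ^+ 2 ->
  norm2 (yD - PhiD *m b0) ^+ 2 <= (eta * f0) ^+ 2 ->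
  (forall i, `|a0 i 0| <= f0) -> (forall i, `|b0 i 0| <= f0) ->
  (forall i, f0 * x0 i 0 = Num.max `|a0 i 0| `|b0 i 0|) ->
  (T0 = supp a0 /\ supp b0 \subset T0) \/
    (T0 = supp b0 /\ supp a0 \subset T0) ->
  jbp_optimal PhiI PhiD yI yD f0 f0 (eta * f0) (eta * f0) xopt aopt bopt ->
  (0 < M)%N ->
  is_ric A M deltaM -> is_ric A (M + #|T0|) deltaMT ->
  0 < jbp_denom M #|T0| deltaM deltaMT ->
  norm2 (col_mx a0 b0 - col_mx aopt bopt) ^+ 2 <=
    (#|T0|%:R / M%:R * (C + gamma * Num.sqrt #|T0|%:R) ^+ 2 + C ^+ 2)
      * f0 ^+ 2.
Proof.
move=> T0 gamma A C nyI _ eta0 _ resI0 resD0 a0f b0f x0E _.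
move=> [[_ resI resD axopt bxopt] opt] M0 [ripM _] [ripMT _] D0.
have f00 : 0 <= f0 by rewrite -nyI norm2_ge0.
have e0 : 0 <= eta * f0 by rewrite mulr_ge0.
have off i : i \notin T0 -> a0 i 0 = 0 /\ b0 i 0 = 0.
  rewrite inE negbK => /eqP xi; have := x0E i; rewrite xi mulr0 => m0.
  split; apply/eqP; rewrite -normr_le0 m0 le_max lexx ?orbT //.
pose c i := Num.max `|a0 i 0| `|b0 i 0|.
(* Optimality against the competitor [(x0, a0, b0)], scaled by [f0]. *)
have le_c : f0 * \sum_i xopt i 0 <= \sum_(i in T0) c i.
  have -> : \sum_(i in T0) c i = f0 * \sum_i x0 i 0.
    rewrite mulr_sumr [LHS]big_mkcond; apply: eq_bigr => i _.
    by rewrite x0E; case: ifPn => // /off [-> ->]; rewrite normr0 maxxx.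
  (* For [f0 = 0] the equation [x0E] does not confine [x0] to the unit interval, but both sides
     vanish. *)
  have [fp|fn] := ltP 0 f0; last first.
    by have -> : f0 = 0 by [apply/eqP; rewrite eq_le fn]; rewrite !mul0r.
  apply: ler_wpM2l => //; apply: (opt _ a0 b0); split=> // i.
  - rewrite -(ler_pM2l fp) -[x0 i 0 <= 1](ler_pM2l fp) mulr0 mulr1 x0E.
    by rewrite le_max normr_ge0 ge_max a0f b0f.
  - by rewrite x0E le_max lexx.
  - by rewrite x0E le_max lexx orbT.
pose ga := \sum_(i in T0) (c i - `|a0 i 0|).
pose gb := \sum_(i in T0) (c i - `|b0 i 0|).
have gab : ga + gb <= gamma * #|T0|%:R * f0.
  rewrite -big_split /= mulrAC [leRHS]mulr_natr -sumr_const.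
  by apply: ler_sum => i iT; exact: similarity_gap.
set s := Num.sqrt (1 + deltaM); set l := Num.sqrt (1 - deltaMT).
have s0 : 0 <= s by exact: sqrtr_ge0.
(* Two vectors that fit [y] up to [eta * f0] have images at distance at most twice that. *)
have res m (Phi : 'M[R]_(m, N)) (y : 'cV[R]_m) (z z' : 'cV[R]_N) :
    norm2 (y - Phi *m z) ^+ 2 <= (eta * f0) ^+ 2 ->
    norm2 (y - Phi *m z') ^+ 2 <= (eta * f0) ^+ 2 ->
    norm2 (Phi *m (z - z')) <= eta * f0 + eta * f0.
  rewrite !ler_sqr ?nnegrE ?norm2_ge0 // => Hz Hz'.
  have -> : Phi *m (z - z') = (y - Phi *m z') - (y - Phi *m z).
    by rewrite mulmxBr opprB [RHS]addrC addrA subrK.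
  by apply: le_trans (ler_norm2B _ _) _; exact: lerD.
have l1 (z : 'cV[R]_N) : (forall i, `|z i 0| <= f0 * xopt i 0) ->
    \sum_i `|z i 0| <= \sum_(i in T0) c i.
  by move=> Hz; apply: le_trans le_c; rewrite mulr_sumr; exact: ler_sum.
have [u [u0 Du tu Nu]] : exists w, [/\ 0 <= w,
    (Num.sqrt M%:R * l - Num.sqrt #|T0|%:R * s) * w <=
      Num.sqrt M%:R * norm2 (PhiI *m (a0 - aopt)) + s * ga,
    0 <= Num.sqrt #|T0|%:R * w + ga &
    norm2 (a0 - aopt) ^+ 2 <=
      (Num.sqrt #|T0|%:R * w + ga) ^+ 2 / M%:R + w ^+ 2].
  apply: sparse_error => //.
  - by move=> z /(rip_block_diag ripMT) [/andP[]].
  - by move=> z /(rip_block_diag ripM) [/andP[]].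
  - by apply: cone_condition; [move=> i /off [] | exact: l1].
have [v [v0 Dv tv Nv]] : exists w, [/\ 0 <= w,
    (Num.sqrt M%:R * l - Num.sqrt #|T0|%:R * s) * w <=
      Num.sqrt M%:R * norm2 (PhiD *m (b0 - bopt)) + s * gb,
    0 <= Num.sqrt #|T0|%:R * w + gb &
    norm2 (b0 - bopt) ^+ 2 <=
      (Num.sqrt #|T0|%:R * w + gb) ^+ 2 / M%:R + w ^+ 2].
  apply: sparse_error => //.
  - by move=> z /(rip_block_diag ripMT) [_ /andP[]].
  - by move=> z /(rip_block_diag ripM) [_ /andP[]].
  - by apply: cone_condition; [move=> i /off [] | exact: l1].
set sM := Num.sqrt M%:R in Du Dv.
set sT := Num.sqrt #|T0|%:R in Du Dv tu tv Nu Nv *.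
have sM0 : 0 <= sM by exact: sqrtr_ge0.
have sT0 : 0 <= sT by exact: sqrtr_ge0.
have sTE : sT ^+ 2 = #|T0|%:R by rewrite sqr_sqrtr ?ler0n.
have DE : jbp_denom M #|T0| deltaM deltaMT = sM * l - sT * s.
  by rewrite /jbp_denom !sqrtrM ?ler0n.
(* Adding [Du] and [Dv], the two residual bounds [2 * eta * f0] make the 4 in [C], and [gab] makes
   its second term. *)
have uv : u + v <= C * f0.
  rewrite /C /jbp_const mulrAC ler_pdivlMr // DE mulrC mulrDr.
  have eu := ler_wpM2l sM0 (res _ _ _ _ _ resI0 resI).
  have ev := ler_wpM2l sM0 (res _ _ _ _ _ resD0 resD).
  have sg := ler_wpM2l s0 gab.
  rewrite -/sM -/s; lra.
(* Since [sT ^+ 2] is the size of [T0], the total slack is at most [sT * (gamma * sT) * f0], and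
   [sT] factors out. *)
have tuv : (sT * u + ga) + (sT * v + gb) <= sT * (C + gamma * sT) * f0.
  have := ler_wpM2l sT0 uv; move: gab; rewrite -sTE; lra.
have sqD p q r : 0 <= p -> 0 <= q -> p + q <= r ->
    p ^+ 2 + q ^+ 2 <= r ^+ 2 :> R.
  by move=> *; nra.
have sq_w := sqD _ _ _ u0 v0 uv.
have sq_t := ler_wpM2r (_ : 0 <= M%:R^-1) (sqD _ _ _ tu tv tuv).
rewrite opp_col_mx add_col_mx norm2_col_mx.
apply: le_trans (lerD Nu Nv) _; rewrite addrACA -mulrDl.
apply: le_trans (lerD (sq_t _) sq_w) _; first by rewrite invr_ge0 ler0n.
by rewrite -sTE le_eqVlt; apply/orP; left; apply/eqP; ring.
Qed.
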